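(* Let $n,m\in\mathbb{N}$, and let $X$ be an $n\times m$ random matrix with entries $X_{ij}=b_{ij}\xi_{ij}$, where $b_{ij}\ge 0$ are arbitrary scalars and $\xi_{ij}$ ($i\le n$, $j\le m$) are independent, symmetrically distributed real random variables with $\mathbf{E}[\xi_{ij}^{2p}]\le \mathbf{E}[g^{2p}]$ for all $i,j$ and all $p\in\mathbb{N}$, where $g\sim N(0,1)$. Let $$\sigma_1^2 := \max_{j\le m}\sum_{i\le n} b_{ij}^2,\qquad \sigma_2^2:=\max_{i\le n}\sum_{j\le m} b_{ij}^2,\qquad \sigma_*^2:=\max_{i\le n,\,j\le m} b_{ij}^2,$$ and assume $\sigma_*=1$. Then $$\mathbf{E}[\mathrm{tr}\,(XX^* )^p]\le \mathbf{E}[\mathrm{tr}\,(YY^* )^p]\quad\text{for all }p\in\mathbb{N},$$ where $Y$ is the $\lceil\sigma_1^2\rceil\times\lceil\sigma_2^2\rceil$ matrix with independent entries $Y_{ij}\sim N(0,1)$.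
   Context: For a $k\times k$ matrix $M$, $\mathrm{tr}\,M:=\frac1k\sum_{i=1}^k M_{ii}$ denotes the normalized trace (so each side is normalized by the dimension of its own matrix: $n$ on the left, $\lceil\sigma_1^2\rceil$ on the right). $M^*$ denotes the adjoint. ''Symmetrically distributed'' means that $\xi_{ij}$ and $-\xi_{ij}$ have the same law. *)

(* Defs.v *)
From HB Require Import structures.
From mathcomp Require Import all_boot all_order all_algebra.
From mathcomp Require Import all_classical all_reals all_analysis.

Set Implicit Arguments.
Unset Strict Implicit.
Unset Printing Implicit Defensive.

Import Order.TTheory GRing.Theory Num.Theory.
Import numFieldNormedType.Exports.

Local Open Scope classical_set_scope.
Local Open Scope ring_scope.

(* Equality only on measurable sets: a measure is total on [set U] and its
   values outside the sigma-algebra carry no meaning. *)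
Definition same_law (d : measure_display) (U : measurableType d) (R : realType)
    (mu nu : set U -> \bar R) : Prop :=
  forall A : set U, measurable A -> mu A = nu A.

Definition symmetric_law (d : measure_display) (T : measurableType d)
    (R : realType) (P : probability T R) (X : {RV P >-> R}) : Prop :=
  same_law (distribution P X) (pushforward P (fun w => - X w)).

Definition std_normal (d : measure_display) (T : measurableType d)
    (R : realType) (P : probability T R) (X : {RV P >-> R}) : Prop :=
  same_law (distribution P X) (normal_prob 0 1).

Definition mutually_independent (d : measure_display) (T : measurableType d)
    (R : realType) (P : probability T R) (I : finType)
    (X : I -> {RV P >-> R}) : Prop :=
  forall (J : {set I}) (A : I -> set R), (forall i, measurable (A i)) ->
    P (\bigcap_(i in [set` J]) (X i @^-1` A i))
    = (\prod_(i in J) P (X i @^-1` A i))%E.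

Definition ntrace (R : realType) (k : nat) (M : 'M[R]_k) : R :=
  k%:R^-1 * \tr M.

(* The maxima are of nonnegative quantities, so the base value 0 only matters
   over an empty index set. *)
Definition sigma1_sq (R : realType) (n m : nat) (b : 'M[R]_(n, m)) : R :=
  \big[Num.max/0]_(j < m) \sum_(i < n) b i j ^+ 2.

Definition sigma2_sq (R : realType) (n m : nat) (b : 'M[R]_(n, m)) : R :=
  \big[Num.max/0]_(i < n) \sum_(j < m) b i j ^+ 2.

Definition sigmastar_sq (R : realType) (n m : nat) (b : 'M[R]_(n, m)) : R :=
  \big[Num.max/0]_(i < n) \big[Num.max/0]_(j < m) b i j ^+ 2.

Definition sigmastar (R : realType) (n m : nat) (b : 'M[R]_(n, m)) : R :=
  Num.sqrt (sigmastar_sq b).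

(* [Num.ceil] is [int]-valued; the absolute value is the identity for the
   arguments [0 <= x] used here. *)
Definition nceil (R : realType) (x : R) : nat := `|Num.ceil x|%N.

(* E[tr (Z Z^* )^p] for a real random matrix Z, whose adjoint is its transpose;
   the integrand is nonnegative, and the expectation is valued in [\bar R]. *)
Definition trace_moment (d : measure_display) (T : measurableType d)
    (R : realType) (P : probability T R) (k l : nat) (Z : T -> 'M[R]_(k, l))
    (p : nat) : \bar R :=
  ('E_P[fun w => ntrace ((Z w *m (Z w)^T) ^+ p)%R])%E.

(* Main.v *)
Require Import Defs.
From HB Require Import structures.
From mathcomp Require Import all_boot all_order all_algebra.
From mathcomp Require Import all_classical all_reals all_analysis.

From mathcomp Require Import measurable_realfun ring lra.

Set Implicit Arguments.
Unset Strict Implicit.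
Unset Printing Implicit Defensive.

Import Order.TTheory GRing.Theory Num.Theory.
Import numFieldNormedType.Exports.

Local Open Scope classical_set_scope.
Local Open Scope ring_scope.

(** Write tr (Z Z^T)^p as a sum over closed walks of length 2p that alternate
    between rows and columns of Z, each weighted by the product of the entries
    it traverses ([mxtrace_walks]).  By independence, the expected weight of a
    walk factorises into moments of single entries ([mixed_moment]).  The odd
    moments vanish by symmetry and the even ones are at most Gaussian, so
    replacing the xi_ij by independent Gaussians can only increase the left
    side.

    For Gaussians, Wick's formula ([wick_formula]) turns the product of moments
    along a walk into the number of pairings of its 2p steps in which paired
    steps traverse the same entry.  Exchanging the two sums, it suffices to
    compare the two sides for each fixed pairing pi ([pairing_compare]).

    A fixed pairing imposes equalities between vertices of the walk, and
    nothing else.  Reveal the vertices one at a time: each is either forced to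
    equal an earlier one or is fresh, that is, free.  Two paired steps cannot
    both lead to a fresh vertex, since the later one ends on an endpoint of the
    earlier one ([fresh_pair]).  As paired steps carry the same weight and
    every b_ij is at most sigma_* = 1, the weight of the walk is at most the
    product of b^2 over the steps to fresh vertices ([weight_le]).  Summing out
    the last vertex first, each fresh column costs at most sigma_2^2 and each
    fresh row at most sigma_1^2 ([reveal_le]).  On the side of Y the same
    process counts walks on a complete bipartite graph, where each fresh vertex
    contributes exactly ceil(sigma_2^2) or ceil(sigma_1^2) ([reveal_ge]).  The
    starting row contributes n, respectively ceil(sigma_1^2), and this is what
    the normalisation of the trace removes.

    Working with pairings, rather than with the set of distinct vertices that a
    walk visits, is what makes the comparison exact in the dimension: fresh
    vertices range over all rows or columns, so powers of the dimensions appear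
    instead of falling factorials. *)

(** * Gaussian moments as numbers of pairings *)

(** The moments E[g^k] of a standard normal g: (k-1)!! for even k and 0 for odd
    k. *)
Fixpoint gauss_moment (k : nat) : nat :=
  match k with
  | 0 => 1
  | k1.+1 => if k1 is k2.+1 then (k1 * gauss_moment k2)%N else 0
  end.

(** All perfect matchings of the positions of [s]: the first element is matched
    with each of the others in turn.  The counter [n] only makes the recursion
    structural; any [n >= size s] gives the same list. *)
Fixpoint pairings_rec (T : eqType) (n : nat) (s : seq T) : seq (seq (T * T)) :=
  match s with
  | [::] => [:: [::]]
  | a :: s' => if n is n'.+1 then
      [seq (a, b) :: pi | b <- s', pi <- pairings_rec n' (rem b s')]
    else [::]
  end.

Definition pairings (T : eqType) (s : seq T) := pairings_rec (size s) s.

(** If the first element has colour c, and k of the others do, the k ways to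
    match it inside its colour leave k-1 elements of that colour; this is the
    recursion E[g^(k+1)] = k E[g^(k-1)], while the other colours are
    untouched. *)
Lemma wick_formula (T : eqType) (C : finType) (c : T -> C) (s : seq T) :
  (\sum_(pi <- pairings s) \prod_(ab <- pi) (c ab.1 == c ab.2) =
   \prod_(i : C) gauss_moment (count (fun t => c t == i) s))%N.
Proof.
rewrite /pairings; move: {2 3}(size s) (leqnn (size s)) => n.
elim: n s => [|n IHn] [|a s] //= sz; try by
  rewrite big_seq1 big_nil big1_eq.
rewrite big_allpairs_dep /= [RHS](bigD1 (c a)) //= eqxx add1n.
under [X in (_ * X)%N]eq_bigr => i ica do rewrite eq_sym (negPf ica) add0n.
set Q := (\prod_(i | i != c a) _)%N.
set k := count _ s.
transitivity (\sum_(b <- s | c b == c a) (gauss_moment k.-1 * Q))%N.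
  rewrite [RHS]big_mkcond /= big_seq [RHS]big_seq; apply: eq_bigr => b bs.
  under eq_bigr => pi _ do rewrite big_cons /=.
  rewrite -big_distrr /= IHn; last first.
    by rewrite size_rem // (leq_trans (leq_pred _)).
  rewrite [c b == _]eq_sym; case: eqP => [cab|]; last by rewrite mul0n.
  rewrite mul1n (bigD1 (c a)) //=; congr (gauss_moment _ * _)%N.
    by rewrite count_rem bs -cab eqxx subn1.
  apply: eq_bigr => i ica; congr gauss_moment.
  by rewrite count_rem bs -cab [c a == i]eq_sym (negPf ica) subn0.
rewrite big_const_seq iter_addn_0 mulnC mulnA.
by rewrite -/k; case: (k).
Qed.

Lemma pairings_perm (T : eqType) (s : seq T) (pi : seq (T * T)) :
  pi \in pairings s -> perm_eq (flatten [seq [:: ab.1; ab.2] | ab <- pi]) s.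
Proof.
rewrite /pairings; move: {1}(size s) => n.
elim: n s pi => [|n IHn] [|a s] pi //=.
- by rewrite inE => /eqP ->.
- by rewrite inE => /eqP ->.
case/allpairsPdep => b [pi' [bs pi'P ->]] /=.
rewrite perm_cons (perm_trans (y := b :: rem b s)) //.
  by rewrite perm_cons IHn.
by rewrite perm_sym perm_to_rem.
Qed.

(** * Sums over walks *)

Section walks.
Implicit Types (K : nat -> nat) (x : nat -> nat).

Definition upd x T v : nat -> nat := fun t => if t == T then v else x t.

(** A walk with [T] vertices is a function on [nat] whose values from [T] on are
    0, so that extending a walk is a pointwise update and needs no change of
    type.  [K t] is the number of possible values of vertex [t]. *)
Fixpoint walks K T : seq (nat -> nat) :=
  if T is T'.+1 then [seq upd x T' v | x <- walks K T', v <- iota 0 (K T')]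
  else [:: fun=> 0%N].

Definition bounded K T x := all (fun t => (x t < K t)%N) (iota 0 T).

Lemma boundedP K T x : reflect (forall t, (t < T)%N -> (x t < K t)%N) (bounded K T x).
Proof.
apply: (iffP allP) => [H t tT|H t]; first by apply: H; rewrite mem_iota.
by rewrite mem_iota add0n => /H.
Qed.

Lemma updx x T v : upd x T v T = v. Proof. by rewrite /upd eqxx. Qed.

Lemma upd_lt x T v t : (t < T)%N -> upd x T v t = x t.
Proof. by move=> tT; rewrite /upd ltn_eqF. Qed.

Lemma all_walks K T : all (bounded K T) (walks K T).
Proof.
elim: T => [|T IHT] //=.
elim: (walks K T) IHT => [|x s IHs] //= /andP[xb sb].
rewrite all_cat IHs // andbT all_map; apply/allP => v.
rewrite mem_iota add0n => vK; apply/boundedP => t; rewrite ltnS leq_eqVlt.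
case/predU1P => [->|tT]; first by rewrite updx.
by rewrite upd_lt //; apply: (boundedP _ _ _ xb).
Qed.

Section sums.
Variable V : nmodType.

Lemma sum_walksS K T (F : (nat -> nat) -> V) :
  \sum_(x <- walks K T.+1) F x =
  \sum_(x <- walks K T) \sum_(v < K T) F (upd x T v).
Proof.
rewrite /= big_allpairs_dep; apply: eq_bigr => x _.
by have -> : iota 0 (K T) = index_iota 0 (K T); [rewrite /index_iota subn0 | rewrite big_mkord].
Qed.

Lemma sum_walks_bounded K T (F : (nat -> nat) -> V) :
  \sum_(x <- walks K T) F x = \sum_(x <- walks K T | bounded K T x) F x.
Proof.
have /all_filterP {1}<- := all_walks K T.
by rewrite big_filter.
Qed.
End sums.
End walks.

(** * Revealing the vertices of a walk one at a time *)

Section reveal.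
Variables (R : numDomainType) (r : rel nat).
Hypotheses (r_sym : symmetric r) (r_trans : transitive r).
Implicit Types (K : nat -> nat) (x : nat -> nat).

(** [r] says which vertices of a walk are forced to coincide. *)
Definition respects T x :=
  [forall s : 'I_T, forall t : 'I_T, r s t ==> (x s == x t)].

Definition fresh t := [forall s : 'I_t, ~~ r s t].

Lemma respectsP T x :
  reflect (forall s t, (s < T)%N -> (t < T)%N -> r s t -> x s = x t)
          (respects T x).
Proof.
apply: (iffP forallP) => [H s t sT tT rst|H s].
  by have /forallP/(_ (Ordinal tT))/implyP/(_ rst)/eqP := H (Ordinal sT).
by apply/forallP => t; apply/implyP => /H ->.
Qed.

Lemma freshPn t : reflect (exists2 s, (s < t)%N & r s t) (~~ fresh t).
Proof.
rewrite /fresh negb_forall; apply: (iffP existsP) => [[s]|[s st rst]].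
  by rewrite negbK => rst; exists s.
by exists (Ordinal st); rewrite negbK.
Qed.

Lemma respectsS T x v :
  respects T.+1 (upd x T v) =
  respects T x && [forall s : 'I_T, r s T ==> (x s == v)].
Proof.
apply/respectsP/andP => [H|[/respectsP H1 /forallP H2] s t].
  split; first apply/respectsP => s t sT tT rst.
    have := H s t (ltnW sT) (ltnW tT) rst.
    by rewrite !upd_lt.
  apply/forallP => s; apply/implyP => rsT.
  have := H s T (leqW (ltn_ord s)) (ltnSn _) rsT.
  by rewrite updx upd_lt // => ->.
rewrite !ltnS [(s <= T)%N]leq_eqVlt [(t <= T)%N]leq_eqVlt.
case/predU1P => [->|sT] /predU1P[->|tT] rst //; rewrite ?updx ?upd_lt //.
- rewrite r_sym in rst.
  by have /implyP/(_ rst)/eqP -> := H2 (Ordinal tT).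
- by have /implyP/(_ rst)/eqP -> := H2 (Ordinal sT).
- exact: H1.
Qed.

Lemma prod_upd (w : nat -> nat -> nat -> R) T x v :
  \prod_(t < T) (if fresh t.+1 then w t (upd x T.+1 v t) (upd x T.+1 v t.+1) else 1)
  = \prod_(t < T) (if fresh t.+1 then w t (x t) (x t.+1) else 1).
Proof.
apply: eq_bigr => t _; rewrite !upd_lt ?ltnS //; exact: leq_trans (ltn_ord t) (leqnSn T).
Qed.

Lemma respects1 x : respects 1 x.
Proof. by apply/respectsP => s t; rewrite !ltnS !leqn0 => /eqP -> /eqP ->. Qed.

(** Summing out the last vertex: if it is fresh, it is unconstrained and
    contributes at most [N]; otherwise it has at most one admissible value. *)
Lemma reveal_le K (w : nat -> nat -> nat -> R) (N : nat -> R) T :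
  (forall t u v, 0 <= w t u v) ->
  (forall t u, \sum_(v < K t.+1) w t u v <= N t.+1) ->
  \sum_(x <- walks K T.+1) (respects T.+1 x)%:R *
      \prod_(t < T) (if fresh t.+1 then w t (x t) (x t.+1) else 1)
  <= (K 0)%:R * \prod_(t < T) (if fresh t.+1 then N t.+1 else 1).
Proof.
move=> w_ge0 wN.
have N_ge0 t : 0 <= N t.+1 by apply: le_trans (wN t 0); apply: sumr_ge0.
elim: T => [|T IHT].
  rewrite sum_walksS /= big_seq1 !big_ord0 mulr1.
  under eq_bigr => v _ do rewrite respects1 big_ord0 mulr1.
  by rewrite sumr_const card_ord.
rewrite sum_walksS [X in _ <= _ * X]big_ord_recr /= mulrA.
under eq_bigr => x _.
  under eq_bigr => v _ do
    rewrite respectsS big_ord_recr /= prod_upd updx upd_lt // mulrA -mulnb natrM.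
  over.
set Q := (X in _ <= X * _).
case: ifPn => [fT|/freshPn[s sT rsT]].
  apply: le_trans (ler_wpM2r (N_ge0 _) IHT).
  rewrite mulr_suml; apply: ler_sum => x _.
  have fx v : [forall s : 'I_T.+1, r s T.+1 ==> (x s == v)].
    by apply/forallP => s; move/forallP: fT => /(_ s) /negPf ->.
  under eq_bigr => v _ do rewrite fx mulr1.
  rewrite -mulr_sumr; apply: ler_wpM2l; last exact: wN.
  rewrite mulr_ge0 ?ler0n //.
  by apply: prodr_ge0 => t _; case: ifP.
rewrite mulr1; apply: le_trans IHT; apply: ler_sum => x _.
set c := _%:R; set P := \prod_(t < T) _.
have P_ge0 : 0 <= c * P.
  rewrite mulr_ge0 ?ler0n //.
  by apply: prodr_ge0 => t _; case: ifP.
apply: (@le_trans _ _ (\sum_(v < K T.+1) (c * P) * (v == x s :> nat)%:R)).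
  apply: ler_sum => v _; rewrite mulr1 mulrAC ler_wpM2l // ler_nat.
  case: forallP => // /(_ (Ordinal sT)) /=.
  by rewrite rsT /= eq_sym => ->.
rewrite -mulr_sumr ler_piMr //.
rewrite -natr_sum lern1.
case: (ltnP (x s) (K T.+1)) => xsK.
  rewrite (bigD1 (Ordinal xsK)) //= eqxx big1 // => i.
  by rewrite -val_eqE /= => /negPf ->.
by rewrite big1 // => i _; rewrite ltn_eqF // (leq_trans _ xsK).
Qed.

(** The converse count with unit weights.  A vertex that is not fresh always has
    an admissible value: transitivity makes the earlier vertices related to it
    agree, and [rK] makes their common value lie in the right range. *)
Lemma reveal_ge K T :
  (forall s t, r s t -> K s = K t) ->
  (K 0)%:R * \prod_(t < T) (if fresh t.+1 then (K t.+1)%:R else 1)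
  <= \sum_(x <- walks K T.+1) (respects T.+1 x)%:R :> R.
Proof.
move=> rK; elim: T => [|T IHT].
  rewrite sum_walksS /= big_seq1 !big_ord0 mulr1.
  under eq_bigr => v _ do rewrite respects1.
  by rewrite sumr_const card_ord.
rewrite [leRHS]sum_walksS big_ord_recr mulrA.
under [leRHS]eq_bigr => x _.
  under eq_bigr => v _ do rewrite respectsS -mulnb natrM.
  over.
case: ifPn => [fT|/freshPn[s sT rsT]].
  apply: le_trans (ler_wpM2r (ler0n _ _) IHT) _.
  rewrite mulr_suml; apply: ler_sum => x _.
  have fx v : [forall s : 'I_T.+1, r s T.+1 ==> (x s == v)].
    by apply/forallP => s; move/forallP: fT => /(_ s) /negPf ->.
  under eq_bigr => v _ do rewrite fx mulr1.
  by rewrite sumr_const card_ord mulr_natr.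
rewrite mulr1; apply: le_trans IHT _.
rewrite [leLHS]sum_walks_bounded [leRHS]sum_walks_bounded.
apply: ler_sum => x /boundedP xb.
have xsK : (x s < K T.+1)%N by rewrite -(rK _ _ rsT) xb.
rewrite (bigD1 (Ordinal xsK)) //=.
case: respectsP => [H|_]; last by rewrite mul0r ler_wpDr // sumr_ge0 // => i _; rewrite mul0r.
rewrite mul1r.
have -> : [forall s0 : 'I_T.+1, r s0 T.+1 ==> (x s0 == x s)].
  apply/forallP => s'; apply/implyP => rs'; apply/eqP/H => //.
  by apply: r_trans rs' _; rewrite r_sym.
by rewrite ler_wpDr // sumr_ge0 // => i _; rewrite mul1r ler0n.
Qed.

End reveal.

(** * Comparison for a fixed pairing *)

Section constraints.
Implicit Types (C : seq (nat * nat)) (x : nat -> nat).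

Definition satisfies C x := all (fun c => x c.1 == x c.2) C.

(** The equalities of vertices forced by [C].  Defining them semantically,
    through all labellings, makes the closure of [C] an equivalence relation for
    free. *)
Definition entailed C : rel nat :=
  fun s t => `[< forall x, satisfies C x -> x s = x t >].

Lemma entailedP C s t :
  reflect (forall x, satisfies C x -> x s = x t) (entailed C s t).
Proof. exact: asboolP. Qed.

Lemma entailed_sym C : symmetric (entailed C).
Proof. by move=> s t; apply/entailedP/entailedP => H x /H. Qed.

Lemma entailed_trans C : transitive (entailed C).
Proof.
move=> t s u /entailedP st /entailedP tu; apply/entailedP => x Cx.
by rewrite st // tu.
Qed.

Lemma entailed_constraint C c : c \in C -> entailed C c.1 c.2.
Proof. by move=> cC; apply/entailedP => x /allP/(_ c cC)/eqP. Qed.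

Lemma respects_entailed C T x :
  all (fun c => (c.1 < T)%N && (c.2 < T)%N) C ->
  respects (entailed C) T x = satisfies C x.
Proof.
move=> /allP CT; apply/respectsP/idP => [H|Cx s t _ _ /entailedP]; last exact.
apply/allP => c cC; have /andP[c1T c2T] := CT _ cC.
by rewrite (H c.1 c.2) // entailed_constraint.
Qed.

End constraints.

(** Step [t] joins vertices [t] and [t.+1].  Rows sit at even positions, so
    [lpos t] and [rpos t] are the positions of its row and column end, and
    [edge x t] is the entry that the step traverses. *)
Definition lpos t := if odd t then t.+1 else t.
Definition rpos t := if odd t then t else t.+1.
Definition edge (x : nat -> nat) t := (x (lpos t), x (rpos t)).
Definition sides (n m : nat) t := if odd t then m else n.
Definition pairing_sat (x : nat -> nat) (pi : seq (nat * nat)) :=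
  all (fun ab => edge x ab.1 == edge x ab.2) pi.

(** The first constraint says that the walk is closed. *)
Definition pairing_constraints p (pi : seq (nat * nat)) : seq (nat * nat) :=
  (0, p.*2) ::
  flatten [seq [:: (lpos ab.1, lpos ab.2); (rpos ab.1, rpos ab.2)] | ab <- pi].

Section pairing.
Variables (p : nat) (pi : seq (nat * nat)).
Hypothesis piP : pi \in pairings (iota 0 p.*2).
Let C := pairing_constraints p pi.
Let r := entailed C.

Lemma satisfies_pairing x :
  satisfies C x = (x 0 == x p.*2) && pairing_sat x pi.
Proof.
rewrite /satisfies /C /pairing_constraints /=; congr andb.
elim: (pi) => [|[a b] s IHs] //=.
by rewrite IHs andbA /edge xpair_eqE.
Qed.

Lemma pairing_mem ab : ab \in pi ->
  [/\ (ab.1 < p.*2)%N, (ab.2 < p.*2)%N & ab.1 != ab.2].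
Proof.
have pe := pairings_perm piP => abpi.
have in_fl a : a \in [:: ab.1; ab.2] -> (a < p.*2)%N.
  move=> aab; suff: a \in iota 0 p.*2 by rewrite mem_iota.
  rewrite -(perm_mem pe); apply/flattenP; exists [:: ab.1; ab.2] => //.
  by apply/mapP; exists ab.
split; [by apply: in_fl; rewrite !inE eqxx|by apply: in_fl; rewrite !inE eqxx orbT|].
have := iota_uniq 0 p.*2; rewrite -(perm_uniq pe).
elim: (pi) abpi => [|c s IHs] //=; rewrite inE => /predU1P[<-|abs].
  by rewrite !inE => /andP[/norP[]].
by case/and3P => _ _ /IHs; apply.
Qed.

Lemma pos_bounds t : ((lpos t <= t.+1) && (rpos t <= t.+1))%N.
Proof. by rewrite /lpos /rpos; case: (odd t); rewrite leqnSn leqnn. Qed.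

Lemma constraints_lt : all (fun c => (c.1 < p.*2.+1)%N && (c.2 < p.*2.+1)%N) C.
Proof.
apply/allP => c; rewrite inE => /predU1P[->|] /=; first by rewrite ltnSn.
case/flattenP => _ /mapP[ab /pairing_mem[a2 b2 _] ->].
have /andP[la ra] := pos_bounds ab.1; have /andP[lb rb] := pos_bounds ab.2.
by rewrite !inE => /orP[] /eqP -> /=; rewrite !ltnS;
  apply/andP; split; apply: leq_trans; try eassumption.
Qed.

(** The labelling by parity satisfies all constraints, so no constraint
    identifies a row with a column. *)
Lemma entailed_odd s t : r s t -> odd s = odd t.
Proof.
move=> /entailedP /(_ (fun t => odd t : nat)) H.
suff /H : satisfies C (fun t => odd t : nat) by case: (odd s); case: (odd t).
rewrite satisfies_pairing /= odd_double eqxx /=; apply/allP => ab _.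
rewrite /edge xpair_eqE /lpos /rpos.
by case oa: (odd ab.1); case ob: (odd ab.2); rewrite /= ?oa ?ob.
Qed.

Lemma entailed_pos ab : ab \in pi ->
  r (lpos ab.1) (lpos ab.2) /\ r (rpos ab.1) (rpos ab.2).
Proof.
move=> abpi; split; apply: (@entailed_constraint C (_, _)); rewrite inE;
apply/orP; right; apply/flattenP; (eexists; first by apply/mapP; exists ab);
by rewrite !inE eqxx ?orbT.
Qed.

(** Step [b] ends at its row or its column vertex; either one is identified with
    an endpoint of the earlier step [a]. *)
Lemma fresh_half a b : (a < b)%N ->
  r (lpos a) (lpos b) -> r (rpos a) (rpos b) -> fresh r b.+1 = false.
Proof.
move=> ab rl rr; apply/negbTE/freshPn.
have /andP[la ra] := pos_bounds a.
case ob: (odd b); rewrite /lpos /rpos ob in rl rr.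
  by exists (lpos a) => //; apply: leq_ltn_trans la _; rewrite ltnS.
by exists (rpos a) => //; apply: leq_ltn_trans ra _; rewrite ltnS.
Qed.

Lemma fresh_pair ab : ab \in pi -> fresh r ab.1.+1 && fresh r ab.2.+1 = false.
Proof.
move=> abpi; have [_ _] := pairing_mem abpi; have [rl rr] := entailed_pos abpi.
rewrite neq_ltn => /orP[] lt12; first by rewrite (fresh_half lt12) ?andbF.
by rewrite (fresh_half lt12) // /r entailed_sym.
Qed.

Section compare.
Variables (R : realFieldType) (n m n' m' : nat) (beta : nat * nat -> R).
Hypotheses (n_gt0 : (0 < n)%N) (n'_gt0 : (0 < n')%N).
Hypotheses (beta_ge0 : forall e, 0 <= beta e) (beta_le1 : forall e, beta e <= 1).
Hypotheses (row_sum : forall i, \sum_(j < m) beta (i, j : nat) ^+ 2 <= m'%:R).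
Hypotheses (col_sum : forall j, \sum_(i < n) beta (i : nat, j) ^+ 2 <= n'%:R).

Let step t u v : R := if odd t then beta (v, u) ^+ 2 else beta (u, v) ^+ 2.

Lemma prod_pairing (f : nat -> R) :
  \prod_(t < p.*2) f t = \prod_(ab <- pi) (f ab.1 * f ab.2).
Proof.
rewrite -(big_mkord xpredT f) /index_iota subn0 -(perm_big _ (pairings_perm piP)).
rewrite big_flatten big_map; apply: eq_bigr => ab _.
by rewrite !big_cons big_nil /= mulr1.
Qed.

(** Paired steps a, b have the same weight beta, so together they contribute
    beta^2.  At most one of them leads to a fresh vertex: if one does, beta^2 is
    the factor kept on the right; if none does, beta^2 <= 1 is dropped. *)
Lemma weight_le x : pairing_sat x pi ->
  \prod_(t < p.*2) beta (edge x t) <=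
  \prod_(t < p.*2) (if fresh r t.+1 then step t (x t) (x t.+1) else 1).
Proof.
move=> /allP xpi.
rewrite (prod_pairing (fun t => beta (edge x t))).
rewrite (prod_pairing (fun t => if fresh r t.+1 then step t (x t) (x t.+1) else 1)).
have stepE t : step t (x t) (x t.+1) = beta (edge x t) ^+ 2.
  by rewrite /step /edge /lpos /rpos; case: odd.
rewrite big_seq [leRHS]big_seq; apply: ler_prod => ab abpi.
rewrite mulr_ge0 //= !stepE.
have := fresh_pair abpi; have /eqP -> := xpi _ abpi.
case: ifP => _; case: ifP => _ //= _; rewrite ?mulr1 ?mul1r ?expr2 //.
by rewrite mulr_ile1.
Qed.

(** Both sides are separated by the product of the dimensions [n'] and [m'] over
    the fresh vertices other than the starting one. *)
Lemma pairing_compare :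
  n%:R^-1 * \sum_(x <- walks (sides n m) p.*2.+1)
     ((x 0 == x p.*2) && pairing_sat x pi)%:R * \prod_(t < p.*2) beta (edge x t)
  <= n'%:R^-1 * \sum_(x <- walks (sides n' m') p.*2.+1)
     ((x 0 == x p.*2) && pairing_sat x pi)%:R :> R.
Proof.
have rs : symmetric r by exact: entailed_sym.
have rt : transitive r by exact: entailed_trans.
have respE x : ((x 0 == x p.*2) && pairing_sat x pi) = respects r p.*2.+1 x.
  by rewrite respects_entailed ?satisfies_pairing // constraints_lt.
set D := \prod_(t < p.*2) (if fresh r t.+1 then (sides n' m' t.+1)%:R else 1 : R).
apply: (@le_trans _ _ D).
  rewrite ler_pdivrMl ?ltr0n //.
  apply: le_trans (@reveal_le R r rs (sides n m) step
    (fun t => (sides n' m' t)%:R) p.*2 _ _).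
  - apply: ler_sum => x _; rewrite -respE.
    case: (boolP (_ && _)) => [/andP[_ xpi]|_]; last by rewrite !mul0r.
    by rewrite !mul1r weight_le.
  - by move=> t u v; rewrite /step; case: ifP => _; rewrite exprn_ge0.
  - by move=> t u; rewrite /step /sides /=; case: (odd t) => /=.
rewrite ler_pdivlMl ?ltr0n //.
under [leRHS]eq_bigr => x _ do rewrite respE.
apply: (@reveal_ge R r rs rt (sides n' m') p.*2) => s t /entailed_odd.
by rewrite /sides => ->.
Qed.

End compare.
End pairing.

(** * Traces of powers as sums over walks *)

Section trace_expansion.
Variables (n m : nat) (i0 : 'I_n) (j0 : 'I_m).

(** Walks carry natural numbers, so entries are read off with default indices;
    the defaults are never used on the walks that are summed over. *)
Definition cell (e : nat * nat) : 'I_n * 'I_m := (insubd i0 e.1, insubd j0 e.2).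

Lemma edge_upd x T v t : (t.+1 < T)%N -> edge (upd x T v) t = edge x t.
Proof.
move=> tT; rewrite /edge; have /andP[l_le r_le] := pos_bounds t.
by rewrite !upd_lt // (leq_ltn_trans _ tT).
Qed.

Lemma prod_walk2 (R : comNzRingType) (A : 'M[R]_(n, m)) p x v v' :
  \prod_(t < p.*2.+2) A (cell (edge (upd (upd x p.*2.+1 v) p.*2.+2 v') t)).1
                        (cell (edge (upd (upd x p.*2.+1 v) p.*2.+2 v') t)).2
  = \prod_(t < p.*2) A (cell (edge x t)).1 (cell (edge x t)).2
    * A (insubd i0 (x p.*2)) (insubd j0 v) * A (insubd i0 v') (insubd j0 v).
Proof.
rewrite !big_ord_recr; congr (_ * _ * _); last 2 first.
- rewrite /= /lpos /rpos odd_double.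
  by rewrite upd_lt ?ltnS // upd_lt ?ltnS // upd_lt ?ltnS // updx.
- by rewrite /= /lpos /rpos /= odd_double updx upd_lt // updx.
by apply: eq_bigr => t _; rewrite !edge_upd //= ?ltnS // ltnW.
Qed.

(** Keeping an arbitrary function [f] of the two endpoints makes the induction
    go through: removing the last two steps turns [f] into its contraction with
    A A^T. *)
Lemma walk_sum_power (R : comNzRingType) (A : 'M[R]_(n, m)) (p : nat)
    (f : nat -> nat -> R) :
  \sum_(x <- walks (sides n m) p.*2.+1)
     f (x 0) (x p.*2) *
     \prod_(t < p.*2) A (cell (edge x t)).1 (cell (edge x t)).2
  = \sum_(i < n) \sum_(i' < n) f i i' * ((A *m A^T) ^+ p) i i'.
Proof.
elim: p f => [|p IHp] f.
  rewrite sum_walksS /= big_seq1 /sides /=; apply: eq_bigr => i _.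
  rewrite big_ord0 mulr1 updx expr0 (bigD1 i) //= big1 ?addr0.
    by rewrite mxE eqxx mulr1.
  by move=> i' i'i; rewrite mxE eq_sym (negPf i'i) mulr0.
pose g a b := \sum_(i' < n) f a i' * (A *m A^T) (insubd i0 b) i'.
transitivity (\sum_(i < n) \sum_(k < n) g i k * ((A *m A^T) ^+ p) i k).
  rewrite -IHp doubleS sum_walksS sum_walksS.
  apply: eq_bigr => x _; rewrite /sides /= odd_double /=.
  under eq_bigr => j _ do under eq_bigr => i' _ do
    rewrite prod_walk2 !valKd updx upd_lt // upd_lt //.
  rewrite exchange_big /= /g mulr_suml; apply: eq_bigr => i' _.
  rewrite !mxE mulr_sumr mulr_suml; apply: eq_bigr => j _.
  rewrite mxE -!mulrA; congr (_ * _).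
  by rewrite mulrC mulrA.
apply: eq_bigr => i _; rewrite /g.
under eq_bigr => k _ do rewrite mulr_suml valKd.
rewrite exchange_big /=; apply: eq_bigr => i' _.
rewrite exprSr -mulmxE [X in _ = _ * X]mxE mulr_sumr; apply: eq_bigr => k _.
by rewrite -mulrA [X in _ * X]mulrC.
Qed.

Lemma mxtrace_walks (R : comNzRingType) (A : 'M[R]_(n, m)) (p : nat) :
  \tr ((A *m A^T) ^+ p) =
  \sum_(x <- walks (sides n m) p.*2.+1) (x 0 == x p.*2)%:R *
     \prod_(t < p.*2) A (cell (edge x t)).1 (cell (edge x t)).2.
Proof.
rewrite (walk_sum_power A p (fun a b => (a == b)%:R)); apply: eq_bigr => i _.
rewrite (bigD1 i) //= eqxx mul1r big1 ?addr0 // => i' i'i.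
by rewrite [val i == _]eq_sym val_eqE (negPf i'i) mul0r.
Qed.

Lemma edge_bounded x T t : bounded (sides n m) T x -> (t.+1 < T)%N ->
  ((edge x t).1 < n)%N /\ ((edge x t).2 < m)%N.
Proof.
move=> /boundedP xb tT; have := xb _ tT; have := xb _ (ltnW tT).
by rewrite /sides /edge /lpos /rpos /=; case: (odd t).
Qed.

Lemma cell_inj (e e' : nat * nat) :
  (e.1 < n)%N -> (e.2 < m)%N -> (e'.1 < n)%N -> (e'.2 < m)%N ->
  (cell e == cell e') = (e == e').
Proof.
case: e e' => [a b] [a' b'] /= an bm a'n b'm.
by rewrite /cell /= !xpair_eqE -!val_eqE /= !insubdK.
Qed.

End trace_expansion.

(** * Integration against a density *)

Section density.
Context d d' (T : measurableType d) (U : measurableType d') (R : realType).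
Variables (mu : {measure set T -> \bar R}) (nu : {measure set U -> \bar R}).
Variables (phi : T -> U) (h : T -> R).
Hypotheses (mphi : measurable_fun setT phi) (mh : measurable_fun setT h).
Hypothesis h_ge0 : forall t, 0 <= h t.
Hypothesis density : forall A, measurable A ->
  (\int[mu]_t (\1_A (phi t) * h t)%:E = nu A)%E.
Local Open Scope ereal_scope.
Import HBNNSimple.

Let density_nnsfun (f : {nnsfun U >-> R}) :
  \int[mu]_t (f (phi t) * h t)%:E = \int[nu]_u (f u)%:E.
Proof.
under [RHS]eq_integral do rewrite fimfunE -fsumEFin//.
rewrite [RHS]ge0_integral_fsum//; last 2 first.
- by move=> r; exact/measurable_EFinP/measurableT_comp.
- by move=> r u _; rewrite EFinM nnfun_muleindic_ge0.
have meas r : measurable_fun setT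
    (fun t => r * \1_(f @^-1` [set r]) (phi t) * h t)%R.
  apply: measurable_funM => //; apply: measurable_funM => //.
  by apply: measurableT_comp => //; exact: measurable_indic.
transitivity (\int[mu]_t \sum_(r \in range f)
    (r * \1_(f @^-1` [set r]) (phi t) * h t)%:E).
  apply: eq_integral => t _; rewrite fimfunE EFinM -fsumEFin//.
  rewrite ge0_mule_fsuml => [|r]; last by rewrite EFinM nnfun_muleindic_ge0.
  by apply: eq_fsbigr => r _; rewrite EFinM.
rewrite ge0_integral_fsum//; last 2 first.
- by move=> r; exact/measurable_EFinP.
- move=> r t _; rewrite EFinM mule_ge0 ?lee_fin//.
  by rewrite -lee_fin EFinM nnfun_muleindic_ge0.
apply: eq_fsbigr => r; rewrite inE => -[u _ fur].
have r0 : (0 <= r)%R by rewrite -fur.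
under eq_integral do rewrite -mulrA EFinM.
rewrite ge0_integralZl//; last 2 first.
- apply/measurable_EFinP/measurable_funM => //.
  by apply: measurableT_comp => //; exact: measurable_indic.
- by move=> t _; rewrite lee_fin mulr_ge0.
- by rewrite density// integralZl_indic_nnsfun// integral_indic// setIT.
Qed.

(** The hypothesis is the case of indicators; simple functions follow by
    linearity and nonnegative ones by monotone convergence.  Taking [phi] to be
    the identity gives integration against a density, and taking [phi] to be a
    random variable and [h] a function of the others gives factorisation under
    independence. *)
Lemma ge0_integral_density (f : U -> R) : measurable_fun setT f ->
  (forall u, (0 <= f u)%R) ->
  \int[mu]_t (f (phi t) * h t)%:E = \int[nu]_u (f u)%:E.
Proof.
move=> mf f0.
have mEf : measurable_fun setT (EFin \o f) by exact/measurable_EFinP.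
pose f_ := nnsfun_approx measurableT mEf.
have f_cvg u : EFin \o f_ ^~ u @ \oo --> (f u)%:E.
  by apply: cvg_nnsfun_approx => //= v _; rewrite lee_fin.
transitivity (limn (fun n => \int[nu]_u (f_ n u)%:E)); last first.
  rewrite -monotone_convergence//=.
  - by apply: eq_integral => u _; apply/cvg_lim => //; exact: f_cvg.
  - by move=> n; exact/measurable_EFinP.
  - by move=> n u _; rewrite lee_fin.
  - by move=> u _ m n mn; rewrite lee_fin; exact/lefP/nd_nnsfun_approx.
rewrite (_ : (fun n => _) = (fun n => \int[mu]_t (f_ n (phi t) * h t)%:E)).
  rewrite -monotone_convergence//=.
  - apply: eq_integral => t _; apply/esym/cvg_lim => //.
    under eq_fun do rewrite EFinM.
    by rewrite EFinM; apply: cvgeZr => //; exact: f_cvg.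
  - move=> n; apply/measurable_EFinP/measurable_funM => //.
    by apply: measurableT_comp.
  - by move=> n t _; rewrite lee_fin mulr_ge0.
  - move=> t _ m n mn; rewrite lee_fin ler_wpM2r//.
    exact/lefP/nd_nnsfun_approx.
by apply/funext => n; rewrite density_nnsfun.
Qed.

End density.

(** * Moments of the standard normal law *)

Section normal_moments.
Variable R : realType.
Local Notation mu := (@lebesgue_measure R).
Local Notation phi := (@normal_pdf R 0 1).

Lemma std_normal_pdfE (x : R) :
  phi x = normal_peak 1 * expR (- (x ^+ 2 / 2)).
Proof.
by rewrite normal_pdfE ?oner_eq0// /normal_fun subr0 expr1n mulNr.
Qed.

Lemma is_derive_normal_pdf (x : R) : is_derive x (1 : R) phi (- (x * phi x)).
Proof.
have -> : phi = fun y => normal_peak 1 * expR (- (y ^+ 2 / 2)).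
  by apply/funext => y; exact: std_normal_pdfE.
apply: is_derive_eq.
rewrite /GRing.scale /=.
by field.
Qed.

(** With y = x^2 / 2, one has y^(k+1) <= (k+1)! e^y, and x^(k+1) <= 1 + x^(2(k+1)). *)
Lemma expr_expR_le (k : nat) (x : R) : 0 <= x ->
  x ^+ k.+1 * expR (- (x ^+ 2 / 2)) <= 1 + 2 ^+ k.+1 * k.+1`!%:R.
Proof.
move=> x0; rewrite expRN ler_pdivrMr ?expR_gt0//.
have y0 : 0 <= x ^+ 2 / 2 by rewrite divr_ge0 ?sqr_ge0.
have e1 : 1 <= expR (x ^+ 2 / 2) by rewrite -[leLHS]expR0 ler_expR.
have ek : (x ^+ 2 / 2) ^+ k.+1 / k.+1`!%:R <= expR (x ^+ 2 / 2).
  by apply: le_trans (expR_ge1Dxn k y0); rewrite lerDr.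
rewrite ler_pdivrMr ?ltr0n ?fact_gt0// exprMn exprVn ler_pdivrMr ?exprn_gt0// in ek.
rewrite mulrDl mul1r.
have : x ^+ k.+1 <= 1 + (x ^+ 2) ^+ k.+1.
  rewrite -exprM mulnC exprM.
  have [x1|x1] := leP (x ^+ k.+1) 1; first by rewrite (le_trans x1)// lerDl exprn_ge0 ?exprn_ge0.
  by rewrite expr2 (le_trans (ler_peMr _ (ltW x1)))// ?exprn_ge0// lerDr.
move=> /le_trans; apply; apply: lerD => //.
by rewrite (le_trans ek)// -mulrA mulrC [X in X * _]mulrC.
Qed.

(** Multiplying by one more factor n keeps the sequence bounded, so it is
    O(1/n). *)
Lemma expr_normal_pdf_cvg0 (k : nat) : n%:R ^+ k * phi n%:R @[n --> \oo] --> (0 : R).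
Proof.
rewrite -cvg_shiftS /=.
pose c : R := normal_peak 1 * (1 + 2 ^+ k.+1 * k.+1`!%:R).
apply: (@squeeze_cvgr _ _ _ _ (cst 0) (fun n => c * harmonic n)).
- near=> n; apply/andP; split.
    by rewrite mulr_ge0 ?exprn_ge0// normal_pdf_ge0.
  rewrite /harmonic ler_pdivlMr ?ltr0n// mulrAC -exprSr std_normal_pdfE mulrCA.
  by rewrite ler_wpM2l ?normal_peak_ge0// expr_expR_le.
- exact: cvg_cst.
- by rewrite -[X in _ --> X](mulr0 c); apply: cvgMl_tmp => //; exact: cvg_harmonic.
Unshelve. all: by end_near. Qed.

(** Integration by parts, since x phi(x) is the derivative of -phi. *)
Lemma half_moment_recursion (k : nat) (a : R) : 0 < a ->
  (\int[mu]_(x in `[0%R, a]) (x ^+ k.+2 * phi x)%:E =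
   (- (a ^+ k.+1 * phi a))%:E +
     k.+1%:R%:E * \int[mu]_(x in `[0%R, a]) (x ^+ k * phi x)%:E)%E.
Proof.
move=> a0.
have cphi : continuous phi by apply: continuous_normal_pdf; exact: oner_neq0.
have cX j : continuous (fun x : R => x ^+ j) by exact: exprn_continuous.
have derX (x : R) : is_derive x (1 : R) (fun x : R => x ^+ k.+1) (k.+1%:R * x ^+ k).
  have -> : (fun x : R => x ^+ k.+1) = id ^+ k.+1.
    by apply/funext => y; rewrite exprfctE.
  by apply: is_derive_eq; rewrite /GRing.scale /= mulr1.
have derG (x : R) : is_derive x (1 : R) (fun z => - phi z) (x * phi x).
  have dphi := is_derive_normal_pdf x.
  by apply: is_derive_eq; rewrite opprK.
have c1 : continuous (fun x : R => k.+1%:R * x ^+ k).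
  by move=> x; apply: cvgM; [exact: cvg_cst|exact: cX].
have c2 : continuous (fun x : R => x * phi x).
  by move=> x; apply: cvgM; [exact: cvg_id|exact: cphi].
have cN : continuous (fun x : R => - phi x).
  by move=> x; apply: cvgN; exact: cphi.
under eq_integral do rewrite exprSr -mulrA.
have := @integration_by_parts R (fun x => x ^+ k.+1) (fun x => - phi x)
  (fun x => k.+1%:R * x ^+ k) (fun x => x * phi x) 0 a a0.
move=> ->; last 6 first.
- exact: continuous_subspaceT.
- split; first by move=> x _; have [] := derX x.
    by apply: cvg_at_right_filter; exact: cX.
  by apply: cvg_at_left_filter; exact: cX.
- by move=> x _; rewrite derive1E; have [] := derX x.
- exact: continuous_subspaceT.
- split; first by move=> x _; have [] := derG x.
    by apply: cvg_at_right_filter; exact: cN.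
  by apply: cvg_at_left_filter; exact: cN.
- by move=> x _; rewrite derive1E; have [] := derG x.
rewrite expr0n /= mul0r subr0 mulrN; congr (_ + _)%E.
under eq_integral do rewrite mulrN -mulrA EFinN EFinM.
have xk0 (x : R) : `[0, a]%classic x -> (0 <= (x ^+ k * phi x)%:E)%E.
  rewrite /= in_itv /= => /andP[x0 _].
  by rewrite lee_fin mulr_ge0 ?exprn_ge0 ?normal_pdf_ge0.
rewrite integral_ge0N; last first.
  by move=> x /xk0 h; rewrite mule_ge0// lee_fin.
rewrite oppeK ge0_integralZl//=.
- apply/measurable_EFinP/measurable_funTS/measurable_funM.
    exact: measurable_funX.
  exact: measurable_normal_pdf.
Qed.

Lemma measurable_expr_normal_pdf (k : nat) :
  measurable_fun setT (fun x : R => x ^+ k * phi x).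
Proof.
by apply: measurable_funM; [exact: measurable_funX|exact: measurable_normal_pdf].
Qed.

Lemma moment_half (k : nat) : ~~ odd k ->
  (\int[mu]_x (x ^+ k * phi x)%:E =
   2%:E * \int[mu]_(x in `[0%R, +oo[) (x ^+ k * phi x)%:E)%E.
Proof.
move=> ek; rewrite set_itvcy ge0_symfun_integralT//.
- by move=> x; rewrite mulr_ge0 ?normal_pdf_ge0// exprn_even_ge0.
- move=> x; apply: cvgM; first exact: exprn_continuous.
  by apply: continuous_normal_pdf; exact: oner_neq0.
- move=> x /=; rewrite !std_normal_pdfE sqrrN; congr (_ * _).
  by rewrite exprNn -signr_odd (negPf ek) expr0 mul1r.
Qed.

Lemma cvg_half_moment (k : nat) : ~~ odd k ->
  (\int[mu]_(x in `[0%R, n%:R]) (x ^+ k * phi x)%:E @[n --> \oo] -->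
  \int[mu]_(x in `[0%R, +oo[) (x ^+ k * phi x)%:E)%E.
Proof.
move=> ek; apply: ge0_cvgn_integral; last exact: measurable_expr_normal_pdf.
by move=> x; rewrite mulr_ge0 ?normal_pdf_ge0// exprn_even_ge0.
Qed.

(** Let a tend to infinity in [half_moment_recursion]. *)
Lemma normal_moment_recursion (k : nat) : ~~ odd k ->
  (\int[mu]_x (x ^+ k.+2 * phi x)%:E =
   k.+1%:R%:E * \int[mu]_x (x ^+ k * phi x)%:E)%E.
Proof.
move=> ek; rewrite !moment_half//= ?negbK//.
rewrite muleCA; congr (_ * _)%E.
pose J j n := (\int[mu]_(x in `[0%R, n%:R]) (x ^+ j * phi x)%:E)%E.
have J_cvg j : ~~ odd j ->
  J j @ \oo --> (\int[mu]_(x in `[0%R, +oo[) (x ^+ j * phi x)%:E)%E.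
  by move=> ej; exact: cvg_half_moment.
have J2 : J k.+2 @ \oo --> (0%:E +
    k.+1%:R%:E * \int[mu]_(x in `[0%R, +oo[) (x ^+ k * phi x)%:E)%E.
  apply: (@cvg_trans _ ((fun n : nat => ((- (n%:R ^+ k.+1 * phi n%:R))%:E +
      k.+1%:R%:E * J k n)%E) @ \oo)).
    apply: near_eq_cvg; near=> n.
    by rewrite /J half_moment_recursion// ltr0n; near: n; exact: nbhs_infty_gt.
  apply: cvgeD.
  - by rewrite fin_num_adde_defr.
  - apply: cvg_EFin; first exact: nearW.
    rewrite -[X in _ --> X]oppr0; apply: cvgN.
    exact: expr_normal_pdf_cvg0.
  - by apply: cvgeZl => //; exact: J_cvg.
rewrite add0e in J2; apply: cvg_unique J2 => //.
by apply: J_cvg; rewrite /= negbK.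
Unshelve. all: by end_near. Qed.

Lemma normal_even_moment (p : nat) :
  (\int[mu]_x (x ^+ (2 * p) * phi x)%:E = (gauss_moment (2 * p))%:R%:E)%E.
Proof.
elim: p => [|p IHp].
  rewrite muln0 -(integral_normal_pdf (0 : R) 1).
  by apply: eq_integral => x _; rewrite expr0 mul1r.
rewrite mulnS add2n normal_moment_recursion ?IHp; last by rewrite mul2n odd_double.
by rewrite -EFinM -natrM.
Qed.

Lemma std_normal_even_moment d (T : measurableType d) (P : probability T R)
    (X : {RV P >-> R}) (p : nat) : std_normal X ->
  ('E_P[fun w => (X w ^+ (2 * p))%R] = (gauss_moment (2 * p))%:R%:E)%E.
Proof.
move=> hX; rewrite -normal_even_moment unlock.
have mXp : measurable_fun setT (fun x : R => x ^+ (2 * p)) by exact: measurable_funX.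
have Xp0 (x : R) : 0 <= x ^+ (2 * p) by rewrite exprn_even_ge0// mul2n odd_double.
transitivity (\int[distribution P X]_x (x ^+ (2 * p))%:E)%E.
  by rewrite ge0_integral_distribution//; exact/measurable_EFinP.
(* The normal law and the law of X live on two presentations of the Borel
   sigma-algebra, which the identity relates. *)
apply/esym; pose idR : measurableTypeR R -> R := idfun.
apply: (@ge0_integral_density _ _ _ _ R mu (distribution P X) idR phi) => //.
- by move=> _ B mB; rewrite setTI.
- exact (@measurable_normal_pdf R 0 1).
- by move=> x; exact: normal_pdf_ge0.
- move=> A mA; transitivity (normal_prob (0:R) 1 A); last exact/esym/hX.
  rewrite /normal_prob [RHS]integral_mkcond.
  apply: eq_integral => x _; rewrite patchE indicE.
  by case: ifP => _; rewrite ?mul1r ?mul0r.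
Qed.

(** The density is even and Lebesgue measure is invariant under reflection. *)
Lemma std_normal_symmetric d (T : measurableType d) (P : probability T R)
    (X : {RV P >-> R}) : std_normal X -> symmetric_law X.
Proof.
move=> hX A mA; rewrite hX//.
have mNA : measurable (-%R @^-1` A : set R).
  rewrite -[X in measurable X]setTI.
  have mN : measurable_fun setT (-%R : R -> R) by exact: oppr_measurable.
  exact: mN.
transitivity (distribution P X (-%R @^-1` A)); last by [].
rewrite hX// /normal_prob.
rewrite [LHS](eq_measure_integral (pushforward mu (-%R : _ -> measurableTypeR R))).
  rewrite ge0_integral_pushforward//.
  - by apply: eq_integral => x _ /=; rewrite !std_normal_pdfE sqrrN.
  - by apply/measurable_EFinP/measurable_funTS; exact: measurable_normal_pdf.
  - by move=> x _; rewrite lee_fin normal_pdf_ge0.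
by move=> B mB _; exact/esym/lebesgue_measureN.
Qed.

(** Replacing X by -X gives E[X^k] = - E[X^k]; integrability excludes infinite
    values. *)
Lemma symmetric_odd_moment d (T : measurableType d) (P : probability T R)
    (X : {RV P >-> R}) (k : nat) : symmetric_law X -> odd k ->
  P.-integrable setT (fun w => (X w ^+ k)%:E) ->
  ('E_P[fun w => (X w ^+ k)%R] = 0)%E.
Proof.
move=> sX ok iX; rewrite unlock.
have mk : measurable_fun setT (fun x : R => (x ^+ k)%:E).
  by apply/measurable_EFinP; exact: measurable_funX.
have mN : measurable_fun setT (fun w => - X w) by exact: measurableT_comp.
have E1 : (\int[P]_w (X w ^+ k)%:E = \int[distribution P X]_x (x ^+ k)%:E)%E.
  by rewrite integral_distribution.
have E2 : (\int[distribution P X]_x (x ^+ k)%:E =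
           \int[P]_w ((- X w) ^+ k)%:E)%E.
  rewrite (eq_measure_integral (pushforward P (fun w => - X w))).
    rewrite integral_pushforward//.
    rewrite preimage_setT (_ : _ \o _ = (fun w => - (X w ^+ k)%:E)%E).
      exact: integrableN.
    by apply/funext => w /=; rewrite exprNn -signr_odd ok expr1 mulN1r EFinN.
  by move=> A mA _; exact: sX.
have : (\int[P]_w (X w ^+ k)%:E = - \int[P]_w (X w ^+ k)%:E)%E.
  rewrite {1}E1 E2 -integralN; last by rewrite integrable_add_def.
  apply: eq_integral => w _.
  by rewrite exprNn -signr_odd ok expr1 mulN1r EFinN.
have : (\int[P]_w (X w ^+ k)%:E)%E \is a fin_num by exact: integrable_fin_num.
case: (integral _ _ _) => // r _ [] /eqP.
by rewrite -subr_eq0 opprK -mulr2n mulrn_eq0 /= => /eqP ->.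
Qed.

End normal_moments.

(** * Expectation of a product of independent variables *)

Lemma measurable_fun_bigprod d (T : measurableType d) (R : realType) (J : Type)
    (s : seq J) (Q : pred J) (h : J -> T -> R) :
  (forall i, measurable_fun setT (h i)) ->
  measurable_fun setT (fun w => \prod_(i <- s | Q i) h i w).
Proof.
move=> mh; elim: s => [|i s IHs].
  by rewrite (_ : (fun _ => _) = cst 1)//; apply/funext => w; rewrite big_nil.
rewrite (_ : (fun _ => _) = fun w =>
    (if Q i then h i w else 1) * \prod_(i <- s | Q i) h i w).
  by apply: measurable_funM => //; case: (Q i).
by apply/funext => w; rewrite big_cons; case: ifP => _; rewrite ?mul1r.
Qed.

Section independence.
Context d (T : measurableType d) (R : realType) (P : probability T R).
Variables (I : finType) (X : I -> {RV P >-> R}).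
Hypothesis X_indep : mutually_independent X.
Implicit Type f : I -> R -> R.

Let mean f i : R := fine (\int[P]_w (f i (X i w))%:E)%E.

Let mean_ge0 f i : (forall x, 0 <= f i x) -> 0 <= mean f i.
Proof.
by move=> f0; rewrite fine_ge0// integral_ge0// => w _; rewrite lee_fin.
Qed.

Let mean_indic f i (A : set R) : measurable A -> f i = \1_A ->
  mean f i = fine (P (X i @^-1` A)).
Proof.
move=> mA fA; rewrite /mean fA.
have mXA : measurable (X i @^-1` A) by exact: measurable_funPTI.
by rewrite -[X in fine (P X)]setIT -integral_indic.
Qed.

Let indic_case f :
  (forall i, exists A, measurable A /\ f i = \1_A) ->
  (\int[P]_w (\prod_i f i (X i w))%:E = (\prod_i mean f i)%:E)%E.
Proof.
move=> /choice[A fA].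
have mA i : measurable (A i) by have [] := fA i.
have {}fA i : f i = \1_(A i) by have [] := fA i.
have mXA i : measurable (X i @^-1` A i) by exact: measurable_funPTI.
transitivity (P (\bigcap_(i in [set` [set: I]%SET]) X i @^-1` A i)).
  rewrite -[X in P X]setIT -integral_indic//; last first.
    by apply: fin_bigcap_measurable => //; exact: finite_finset.
  apply: eq_integral => w _; congr (_%:E).
  rewrite indicE; case: (boolP (w \in _)) => [/set_mem wA|/negP wA].
    rewrite big1 // => i _; rewrite fA indicE mem_set//.
    by apply: wA; rewrite /= finset.in_setT.
  apply/eqP; case: (boolP (_ == _)) => //; rewrite -[false%:R]/(0 : R) => /prodf_neq0 h.
  case: wA; apply/mem_set => i _ /=; apply: contrapT => wi.
  by have := h i isT; rewrite fA indicE memNset// eqxx.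
rewrite X_indep// [LHS](eq_bigl xpredT) => [|i]; last by rewrite finset.in_setT.
rewrite -prodEFin; apply: eq_bigr => i _.
by rewrite (mean_indic (mA i) (fA i)) fineK// fin_num_measure.
Qed.

(* One factor at a time can be promoted from an indicator to a nonnegative
   function, the product of the others playing the role of the weight. *)
Let ge0_step f (i0 : I) :
  (forall i, measurable_fun setT (f i)) ->
  (forall i x, 0 <= f i x) ->
  (P.-integrable setT (fun w => (f i0 (X i0 w))%:E)) ->
  (forall A, measurable A ->
     (\int[P]_w (\1_A (X i0 w) * \prod_(i | i != i0) f i (X i w))%:E =
      P (X i0 @^-1` A) * (\prod_(i | i != i0) mean f i)%:E))%E ->
  (\int[P]_w (\prod_i f i (X i w))%:E = (\prod_i mean f i)%:E)%E.
Proof.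
move=> mf f0 intf H.
have c0 : 0 <= \prod_(i | i != i0) mean f i by apply: prodr_ge0 => i _; exact: mean_ge0.
under eq_integral do rewrite (bigD1 i0)//=.
transitivity (\int[mscale (NngNum c0) (distribution P (X i0))]_x (f i0 x)%:E)%E.
  apply: (@ge0_integral_density _ _ _ _ R P
    (mscale (NngNum c0) (distribution P (X i0))) (X i0)) => //.
  - apply: measurable_fun_bigprod => i; exact: measurableT_comp.
  - by move=> w; exact: prodr_ge0.
  - by move=> A mA; rewrite H// muleC.
rewrite ge0_integral_mscale//; last 2 first.
- exact/measurable_EFinP.
- by move=> x _; rewrite lee_fin.
rewrite ge0_integral_distribution//; last 2 first.
- exact/measurable_EFinP.
- by move=> x; rewrite lee_fin.
rewrite [in RHS](bigD1 i0)//= EFinM muleC; congr (_ * _)%E.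
by rewrite /mean fineK//; exact: integrable_fin_num.
Qed.

(* [s] lists the indices whose factor need not be an indicator. *)
Let ge0_upto (s : seq I) f :
  (forall i, measurable_fun setT (f i)) ->
  (forall i x, 0 <= f i x) ->
  (forall i, P.-integrable setT (fun w => (f i (X i w))%:E)) ->
  (forall i, i \notin s -> exists A, measurable A /\ f i = \1_A) ->
  (\int[P]_w (\prod_i f i (X i w))%:E = (\prod_i mean f i)%:E)%E.
Proof.
elim: s f => [|i0 s IHs] f mf f0 intf fs.
  by apply: indic_case => i; exact: fs.
apply: (@ge0_step f i0) => // A mA.
pose g i := if i == i0 then \1_A else f i.
have gne i : i != i0 -> g i = f i by rewrite /g => /negPf ->.
have g0 : g i0 = \1_A by rewrite /g eqxx.
transitivity (\int[P]_w (\prod_i g i (X i w))%:E)%E.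
  apply: eq_integral => w _; rewrite [in RHS](bigD1 i0)//= g0.
  by congr (_ * _)%:E; apply: eq_bigr => i /gne ->.
have mXA : measurable (X i0 @^-1` A) by exact: measurable_funPTI.
rewrite IHs.
- rewrite (bigD1 i0)//= (mean_indic mA g0) EFinM fineK ?fin_num_measure//.
  by congr (_ * _%:E)%E; apply: eq_bigr => i /gne gi; rewrite /mean gi.
- by move=> i; rewrite /g; case: eqP => // _; exact: measurable_indic.
- by move=> i x; rewrite /g; case: eqP.
- move=> i; rewrite /g; case: eqP => // ->.
  exact: (integrable_indic P mXA).
- move=> i i_s; rewrite /g; case: eqP => [_|/eqP ii0]; first by exists A.
  by apply: fs; rewrite inE negb_or ii0.
Qed.

(** The definition of independence is the case of indicators; the factors are
    replaced by nonnegative functions one after the other. *)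
Lemma ge0_expectation_prod f :
  (forall i, measurable_fun setT (f i)) ->
  (forall i x, 0 <= f i x) ->
  (forall i, P.-integrable setT (fun w => (f i (X i w))%:E)) ->
  (\int[P]_w (\prod_i f i (X i w))%:E =
   (\prod_i fine (\int[P]_w (f i (X i w))%:E))%:E)%E.
Proof.
move=> mf f0 intf; apply: (@ge0_upto (enum I)) => // i.
by rewrite mem_enum.
Qed.

Lemma integrable_prod f :
  (forall i, measurable_fun setT (f i)) ->
  (forall i, P.-integrable setT (fun w => (f i (X i w))%:E)) ->
  P.-integrable setT (fun w => (\prod_i f i (X i w))%:E).
Proof.
move=> mf intf; apply/integrableP; split.
  apply/measurable_EFinP/measurable_fun_bigprod => i; exact: measurableT_comp.
under eq_integral do rewrite /= normr_prod.
rewrite (@ge0_expectation_prod (fun i x => `|f i x|)) ?ltry// => i.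
- exact: measurableT_comp.
- by have := integrable_abse (intf i).
Qed.

(* [s] lists the indices whose factor may change sign; each such factor is split
   into its positive and negative parts. *)
Let signed_upto (s : seq I) f :
  (forall i, measurable_fun setT (f i)) ->
  (forall i, P.-integrable setT (fun w => (f i (X i w))%:E)) ->
  (forall i, i \notin s -> forall x, 0 <= f i x) ->
  (\int[P]_w (\prod_i f i (X i w))%:E = (\prod_i mean f i)%:E)%E.
Proof.
elim: s f => [|i0 s IHs] f mf intf fs.
  by apply: ge0_expectation_prod => // i; exact: fs.
pose g (h : R -> R) i := if i == i0 then h \o f i else f i.
have gne h i : i != i0 -> g h i = f i by rewrite /g => /negPf ->.
have g0 h : g h i0 = h \o f i0 by rewrite /g eqxx.
have gprod h w : \prod_i g h i (X i w) =
    h (f i0 (X i0 w)) * \prod_(i | i != i0) f i (X i w).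
  by rewrite (bigD1 i0)//= g0; congr (_ * _); apply: eq_bigr => i /gne ->.
have gmean h : \prod_i mean (g h) i =
    fine (\int[P]_w (h (f i0 (X i0 w)))%:E)%E * \prod_(i | i != i0) mean f i.
  rewrite (bigD1 i0)//= /mean g0; congr (_ * _).
  by apply: eq_bigr => i /gne ->.
pose pos (x : R) := Num.max x 0; pose neg (x : R) := Num.max (- x) 0.
have mpos : measurable_fun setT pos by exact: measurable_maxr.
have mneg : measurable_fun setT neg by exact: measurable_maxr.
have posneg x : x = pos x - neg x.
  by rewrite /pos /neg; case: (lerP 0 x) => x0; case: (lerP 0 (- x)) => x1; lra.
have pos_le x : `|pos x| <= `|x|.
  by rewrite /pos; case: (lerP x 0) => x0; rewrite ?normr0.
have neg_le x : `|neg x| <= `|x|.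
  by rewrite /neg; case: (lerP (- x) 0) => x0; rewrite ?normr0 ?normrN.
have int1 : forall h : R -> R, measurable_fun setT h -> (forall x, `|h x| <= `|x|) ->
    P.-integrable setT (fun w => (h (f i0 (X i0 w)))%:E).
  move=> h mh hle; apply: le_integrable (intf i0) => //; last first.
    by move=> w _; rewrite lee_fin hle.
  apply/measurable_EFinP; apply: (measurableT_comp mh).
  exact: measurableT_comp.
have mg : forall (k : R -> R) i,
    measurable_fun setT k -> measurable_fun setT (g k i).
  by move=> k i mk; rewrite /g; case: eqP => // _; exact: measurableT_comp.
have intg : forall (k : R -> R) i,
    measurable_fun setT k -> (forall x, `|k x| <= `|x|) ->
    P.-integrable setT (fun w => (g k i (X i w))%:E).
  move=> k i mk kle; rewrite /g; case: eqP => [ii0|_]; last exact: intf.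
  by rewrite ii0; exact: int1.
have IH : forall k : R -> R,
    measurable_fun setT k -> (forall x, `|k x| <= `|x|) ->
    (forall x, 0 <= k x) ->
    (\int[P]_w (\prod_i g k i (X i w))%:E = (\prod_i mean (g k) i)%:E)%E.
  move=> k mk kle k0; apply: IHs => [i|i|i si x]; [exact: mg|exact: intg|].
  rewrite /g; case: eqP => [_|/eqP ii0]; first exact: k0.
  by apply: fs; rewrite inE negb_or ii0.
have pos0 x : 0 <= pos x by rewrite /pos le_max lexx orbT.
have neg0 x : 0 <= neg x by rewrite /neg le_max lexx orbT.
transitivity (\int[P]_w ((\prod_i g pos i (X i w))%:E -
                         (\prod_i g neg i (X i w))%:E))%E.
  apply: eq_integral => w _; rewrite -EFinB !gprod -mulrBl -posneg.
  by rewrite (bigD1 i0).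
rewrite integralB_EFin//; last 2 first.
- by apply: integrable_prod => i; [exact: mg|exact: intg].
- by apply: integrable_prod => i; [exact: mg|exact: intg].
rewrite !IH// -EFinB !gmean -mulrBl; congr (_%:E).
rewrite [RHS](bigD1 i0)//=; congr (_ * _).
rewrite /mean -fineB ?integrable_fin_num//; try exact: int1.
rewrite -integralB_EFin//; try exact: int1.
by congr fine; apply: eq_integral => w _; rewrite -EFinB -posneg.
Qed.

(** Multilinearity reduces to nonnegative factors. *)
Lemma expectation_prod f :
  (forall i, measurable_fun setT (f i)) ->
  (forall i, P.-integrable setT (fun w => (f i (X i w))%:E)) ->
  (\int[P]_w (\prod_i f i (X i w))%:E =
   (\prod_i fine (\int[P]_w (f i (X i w))%:E))%:E)%E.
Proof.
move=> mf intf; apply: (@signed_upto (enum I)) => // i.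
by rewrite mem_enum.
Qed.

End independence.

(** * Trace moments of matrices with independent entries *)

Lemma prod_by_count (R : comNzRingType) (T : Type) (I : finType) (c : T -> I)
    (F : I -> R) (s : seq T) :
  \prod_(t <- s) F (c t) = \prod_i F i ^+ count (fun t => c t == i) s.
Proof.
elim: s => [|a s IHs]; first by rewrite big_nil big1.
rewrite big_cons IHs (bigD1 (c a)) //= [RHS](bigD1 (c a)) //= eqxx exprS mulrA.
congr (_ * _); apply: eq_bigr => i ica.
by rewrite eq_sym (negPf ica).
Qed.

Lemma gauss_moment_odd (k : nat) : odd k -> gauss_moment k = 0%N.
Proof.
move=> ok; rewrite -[k]odd_double_half ok add1n.
by elim: (k./2) => // p IHp; rewrite doubleS /= in IHp *; rewrite IHp muln0.
Qed.

Definition moment d (T : measurableType d) (R : realType) (P : probability T R)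
  (X : {RV P >-> R}) (k : nat) : R := fine (\int[P]_w (X w ^+ k)%:E)%E.

Section symmetric_family.
Context d (T : measurableType d) (R : realType) (P : probability T R).
Local Open Scope ereal_scope.

(** Because |x|^k <= 1 + x^(2k). *)
Lemma integrable_moment (X : {RV P >-> R}) (k : nat) :
  'E_P[fun w => (X w ^+ (2 * k))%R] < +oo ->
  P.-integrable setT (fun w => (X w ^+ k)%:E).
Proof.
rewrite unlock => X2k.
have mX j : measurable_fun setT (fun w => (X w ^+ j)%:E).
  by apply/measurable_EFinP; exact: measurable_funX.
have i2k : P.-integrable setT (fun w => (X w ^+ (2 * k))%:E).
  apply/integrableP; split => //.
  under eq_integral do rewrite gee0_abs ?lee_fin ?exprn_even_ge0 ?mul2n ?odd_double//.
  by rewrite -mul2n.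
have i1 : P.-integrable setT (fun=> 1%:E : \bar R).
  exact: finite_measure_integrable_cst.
apply: le_integrable (integrableD measurableT i1 i2k) => // w _.
rewrite -EFinD lee_fin [leRHS]ger0_norm; last first.
  by rewrite addr_ge0// exprn_even_ge0// mul2n odd_double.
rewrite normrX mul2n -addnn exprD -normrX.
have [x0|x0] := leP 0%R (X w ^+ k)%R; last rewrite -mulrNN ltr0_norm//.
  by rewrite ger0_norm//; nra.
by nra.
Qed.

Lemma moment_odd (X : {RV P >-> R}) (k : nat) : symmetric_law X ->
  'E_P[fun w => (X w ^+ (2 * k))%R] < +oo -> odd k -> moment X k = 0%R.
Proof.
move=> sX /integrable_moment iX ok; rewrite /moment.
by have := symmetric_odd_moment sX ok iX; rewrite unlock => ->.
Qed.

Variables (I : finType) (X : I -> {RV P >-> R}).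
Hypothesis X_indep : mutually_independent X.
Hypothesis X_fin : forall i k, 'E_P[fun w => (X i w ^+ (2 * k))%R] < +oo.

Let mX k : measurable_fun setT (fun x : R => (x ^+ k)%R).
Proof. exact: measurable_funX. Qed.

Lemma integrable_mixed_moment (c : nat -> I) (s : seq nat) :
  P.-integrable setT (fun w => (\prod_(t <- s) X (c t) w)%:E).
Proof.
under eq_fun do rewrite (prod_by_count c (fun i => X i _)).
apply: (integrable_prod X_indep (f := fun i x => (x ^+ _)%R)) => i //.
exact: integrable_moment.
Qed.

(** Grouping equal factors gives a product of powers of distinct, hence
    independent, variables. *)
Lemma mixed_moment (c : nat -> I) (s : seq nat) :
  \int[P]_w (\prod_(t <- s) X (c t) w)%:E =
  (\prod_i moment (X i) (count (fun t => c t == i) s))%:E.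
Proof.
under eq_integral do rewrite (prod_by_count c (fun i => X i _)).
apply: (expectation_prod X_indep (f := fun i x => (x ^+ _)%R)) => i //.
exact: integrable_moment.
Qed.

End symmetric_family.

Section trace_moment.
Context d (T : measurableType d) (R : realType) (P : probability T R).
Variables (n m : nat) (i0 : 'I_n) (j0 : 'I_m) (b : 'M[R]_(n, m)).
Variable (X : 'I_n * 'I_m -> {RV P >-> R}).
Hypothesis X_indep : mutually_independent X.
Hypothesis X_fin :
  forall i k, ('E_P[fun w => (X i w ^+ (2 * k))%R] < +oo)%E.

Let c x t := cell i0 j0 (edge x t).

Lemma trace_moment_walks (p : nat) :
  trace_moment P (fun w => \matrix_(i < n, j < m) (b i j * X (i, j) w)) p =
  (n%:R^-1 * \sum_(x <- walks (sides n m) p.*2.+1)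
     (x 0 == x p.*2)%:R * \prod_(t < p.*2) b (c x t).1 (c x t).2 *
     \prod_ij moment (X ij) (count (fun t => c x t == ij) (iota 0 p.*2)))%:E.
Proof.
pose coef x : R := (x 0 == x p.*2)%:R * \prod_(t < p.*2) b (c x t).1 (c x t).2.
have E w : \tr ((\matrix_(i < n, j < m) (b i j * X (i, j) w) *m
    (\matrix_(i < n, j < m) (b i j * X (i, j) w))^T) ^+ p) =
    \sum_(x <- walks (sides n m) p.*2.+1)
      coef x * \prod_(t <- iota 0 p.*2) X (c x t) w.
  rewrite (mxtrace_walks i0 j0); apply: eq_bigr => x _; rewrite -mulrA.
  congr (_ * _); under [LHS]eq_bigr do rewrite mxE -surjective_pairing.
  rewrite big_split /=; congr (_ * _).
  by rewrite -(big_mkord xpredT (fun t => X (c x t) w)) /index_iota subn0.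
rewrite /trace_moment /ntrace unlock.
under eq_integral do rewrite E EFinM -sumEFin.
have intx x : P.-integrable setT
    (fun w => (coef x * \prod_(t <- iota 0 p.*2) X (c x t) w)%:E).
  under eq_fun do rewrite EFinM.
  by apply: integrableZl => //; exact: integrable_mixed_moment.
rewrite integralZl//; last by apply: integrable_sum => // x _; exact: intx.
rewrite integral_sum// EFinM -sumEFin; congr (_ * _)%E; apply: eq_bigr => x _.
under eq_integral do rewrite EFinM.
rewrite integralZl//; last exact: integrable_mixed_moment.
by rewrite mixed_moment// EFinM.
Qed.

End trace_moment.

(** * Wick's formula along walks *)

Lemma prod_nat_of_bool (T : Type) (s : seq T) (q : pred T) :
  (\prod_(t <- s) nat_of_bool (q t))%N = all q s.
Proof. by elim: s => [|a s IHs]; rewrite ?big_nil// big_cons IHs mulnb. Qed.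

Section wick_walks.
Variables (R : realType) (n m : nat) (i0 : 'I_n) (j0 : 'I_m).
Let c x t := cell i0 j0 (edge x t).

Lemma wick_walk (p : nat) (x : nat -> nat) :
  bounded (sides n m) p.*2.+1 x ->
  (\prod_ij gauss_moment (count (fun t => c x t == ij) (iota 0 p.*2)) =
   \sum_(pi <- pairings (iota 0 p.*2)) pairing_sat x pi)%N.
Proof.
move=> xb; rewrite -wick_formula big_seq [RHS]big_seq; apply: eq_bigr => pi piP.
rewrite prod_nat_of_bool; congr nat_of_bool; apply: eq_in_all => ab abpi.
have [a2 b2 _] := pairing_mem piP abpi.
have [a_n a_m] := edge_bounded xb (t := ab.1) a2.
have [b_n b_m] := edge_bounded xb (t := ab.2) b2.
exact: cell_inj.
Qed.

(** Exchange of the sums over walks and over pairings. *)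
Lemma wick_walk_sum (p : nat) (F : (nat -> nat) -> R) :
  \sum_(x <- walks (sides n m) p.*2.+1) (x 0 == x p.*2)%:R * F x *
     \prod_ij (gauss_moment (count (fun t => c x t == ij) (iota 0 p.*2)))%:R =
  \sum_(pi <- pairings (iota 0 p.*2))
    \sum_(x <- walks (sides n m) p.*2.+1)
      ((x 0 == x p.*2) && pairing_sat x pi)%:R * F x.
Proof.
rewrite [RHS]exchange_big [LHS]sum_walks_bounded [RHS]sum_walks_bounded.
apply: eq_bigr => x xb; rewrite -natr_prod wick_walk// natr_sum mulr_sumr.
by apply: eq_bigr => pi _; rewrite -mulnb natrM mulrAC.
Qed.

End wick_walks.

(** * The parameters sigma *)

Section sigma.
Variables (R : realType) (n m : nat) (b : 'M[R]_(n, m)).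

Lemma row_sum_le_sigma2 i : \sum_(j < m) b i j ^+ 2 <= sigma2_sq b.
Proof. exact: le_bigmax. Qed.

Lemma col_sum_le_sigma1 j : \sum_(i < n) b i j ^+ 2 <= sigma1_sq b.
Proof. exact: le_bigmax. Qed.

Lemma entry_le_sigmastar i j : b i j ^+ 2 <= sigmastar_sq b.
Proof. by apply: le_trans (le_bigmax _ _ i); exact: le_bigmax. Qed.

Lemma sigmastar_le_sigma1 : sigmastar_sq b <= sigma1_sq b.
Proof.
have s0 : 0 <= sigma1_sq b by exact: bigmax_ge_id.
apply: bigmax_le => // i _; apply: bigmax_le => // j _.
apply: le_trans (col_sum_le_sigma1 j).
by rewrite (bigD1 i)//= lerDl sumr_ge0// => k _; exact: sqr_ge0.
Qed.

Lemma sigmastar_le_sigma2 : sigmastar_sq b <= sigma2_sq b.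
Proof.
have s0 : 0 <= sigma2_sq b by exact: bigmax_ge_id.
apply: bigmax_le => // i _; apply: bigmax_le => // j _.
apply: le_trans (row_sum_le_sigma2 i).
by rewrite (bigD1 j)//= lerDl sumr_ge0// => k _; exact: sqr_ge0.
Qed.

Lemma nceil_ge (x : R) : x <= (nceil x)%:R.
Proof.
rewrite /nceil natr_absz; apply: le_trans (ceil_ge x) _.
by rewrite ler_int ler_norm.
Qed.

Lemma sigmastar_sq1 : sigmastar b = 1 -> sigmastar_sq b = 1.
Proof.
move=> h; rewrite -[LHS]sqr_sqrtr ?[Num.sqrt _]h ?expr1n//.
exact: bigmax_ge_id.
Qed.

Lemma sigmastar_dims : sigmastar_sq b = 1 -> (0 < n)%N /\ (0 < m)%N.
Proof.
move=> b1; split; rewrite lt0n; apply/eqP => z.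
  suff : sigmastar_sq b <= 0 by rewrite b1 ler10.
  apply: bigmax_le => // i; by have := ltn_ord i; rewrite {2}z.
suff : sigmastar_sq b <= 0 by rewrite b1 ler10.
by apply: bigmax_le => // i _; apply: bigmax_le => // j; have := ltn_ord j; rewrite {2}z.
Qed.

End sigma.

Theorem theorem1p7 (R : realType) (n m : nat) (b : 'M[R]_(n, m))
  (hb : forall i j, 0 <= b i j)
  (dg : measure_display) (Tg : measurableType dg) (Pg : probability Tg R)
  (g : {RV Pg >-> R}) (hg : std_normal g)
  (d : measure_display) (T : measurableType d) (P : probability T R)
  (xi : 'I_n * 'I_m -> {RV P >-> R})
  (xi_indep : mutually_independent xi)
  (xi_sym : forall ij, symmetric_law (xi ij))
  (xi_moments : forall ij (p : nat),
     ('E_P[fun w => (xi ij w ^+ (2 * p))%R] <= 'E_Pg[fun w => (g w ^+ (2 * p))%R])%E)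
  (hsigma : sigmastar b = 1)
  (dY : measure_display) (TY : measurableType dY) (PY : probability TY R)
  (Y : 'I_(nceil (sigma1_sq b)) * 'I_(nceil (sigma2_sq b)) -> {RV PY >-> R})
  (Y_indep : mutually_independent Y)
  (Y_normal : forall ij, std_normal (Y ij)) :
  forall p : nat,
    (trace_moment P (fun w => \matrix_(i < n, j < m) (b i j * xi (i, j) w)%R) p
     <= trace_moment PY (fun w => \matrix_(i, j) Y (i, j) w) p)%E.
Proof.
move=> p; have b1 := sigmastar_sq1 hsigma.
have [n_gt0 m_gt0] := sigmastar_dims b1.
pose i0 := Ordinal n_gt0; pose j0 := Ordinal m_gt0.
set n' := nceil (sigma1_sq b) in Y Y_indep Y_normal *.
set m' := nceil (sigma2_sq b) in Y Y_indep Y_normal *.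
have n'_ge : sigma1_sq b <= n'%:R by exact: nceil_ge.
have m'_ge : sigma2_sq b <= m'%:R by exact: nceil_ge.
have n'_gt0 : (0 < n')%N.
  rewrite -(ltr0n R) (lt_le_trans ltr01)// -[leLHS]b1.
  exact: le_trans (sigmastar_le_sigma1 b) n'_ge.
have m'_gt0 : (0 < m')%N.
  rewrite -(ltr0n R) (lt_le_trans ltr01)// -[leLHS]b1.
  exact: le_trans (sigmastar_le_sigma2 b) m'_ge.
pose i0' := Ordinal n'_gt0; pose j0' := Ordinal m'_gt0.
have xi_le ij k : ('E_P[fun w => (xi ij w ^+ (2 * k))%R] <=
    (gauss_moment (2 * k))%:R%:E)%E.
  by rewrite (le_trans (xi_moments ij k))// std_normal_even_moment.
have xi_fin ij k : ('E_P[fun w => (xi ij w ^+ (2 * k))%R] < +oo)%E.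
  by rewrite (le_lt_trans (xi_le ij k))// ltry.
have Y_fin ij k : ('E_PY[fun w => (Y ij w ^+ (2 * k))%R] < +oo)%E.
  by rewrite std_normal_even_moment// ltry.
have Y_moment ij k : moment (Y ij) k = (gauss_moment k)%:R.
  have [ok|ek] := boolP (odd k).
    by rewrite moment_odd ?gauss_moment_odd//; exact: std_normal_symmetric.
  have := @std_normal_even_moment R _ _ _ (Y ij) k./2 (Y_normal ij).
  by rewrite unlock mul2n even_halfK// /moment => ->.
have xi_moment ij k : 0 <= moment (xi ij) k <= (gauss_moment k)%:R.
  have [ok|ek] := boolP (odd k).
    by rewrite moment_odd ?gauss_moment_odd// lexx.
  have := xi_le ij k./2; rewrite unlock mul2n even_halfK// /moment => le_k.
  have ge_k : (0 <= \int[P]_w (xi ij w ^+ k)%:E)%E.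
    by apply: integral_ge0 => w _; rewrite lee_fin exprn_even_ge0.
  rewrite fine_ge0//= -lee_fin fineK// ge0_fin_numE//.
  by rewrite (le_lt_trans le_k)// ltry.
(* Y is the case of constant coefficients 1. *)
have -> : (fun w => \matrix_(i, j) Y (i, j) w) =
    (fun w => \matrix_(i < n', j < m') (const_mx 1 i j * Y (i, j) w)).
  by apply/funext => w; apply/matrixP => i j; rewrite !mxE mul1r.
rewrite (trace_moment_walks i0 j0)// (trace_moment_walks i0' j0')// lee_fin.
pose beta e := b (cell i0 j0 e).1 (cell i0 j0 e).2.
have beta_le1 e : beta e <= 1.
  rewrite -(@ler_pXn2r _ 2) ?nnegrE ?hb ?ler01// expr1n -[leRHS]b1.
  exact: entry_le_sigmastar.
apply: (@le_trans _ _ (n%:R^-1 * \sum_(x <- walks (sides n m) p.*2.+1)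
    (x 0 == x p.*2)%:R * \prod_(t < p.*2) beta (edge x t) *
    \prod_ij (gauss_moment (count (fun t => cell i0 j0 (edge x t) == ij)
                                  (iota 0 p.*2)))%:R)).
  rewrite ler_wpM2l ?invr_ge0// ler_sum// => x _; rewrite ler_wpM2l//.
    by rewrite mulr_ge0// prodr_ge0// => t _; exact: hb.
  by apply: ler_prod => ij _; exact: xi_moment.
rewrite [in leRHS](eq_bigr (fun x => (x 0 == x p.*2)%:R * 1 *
    \prod_ij (gauss_moment (count (fun t => cell i0' j0' (edge x t) == ij)
                                  (iota 0 p.*2)))%:R)); last first.
  move=> x _; congr (_ * _ * _); last by apply: eq_bigr => ij _.
  by apply: big1 => t _; rewrite mxE.
rewrite (wick_walk_sum i0 j0 p (fun x => \prod_(t < p.*2) beta (edge x t))).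
rewrite (wick_walk_sum i0' j0' p (fun=> 1)) !mulr_sumr.
rewrite big_seq [leRHS]big_seq; apply: ler_sum => pi piP.
under [in leRHS]eq_bigr do rewrite mulr1.
apply: pairing_compare => //.
- by move=> e; exact: hb.
- move=> i; under eq_bigr do rewrite /beta /cell /= valKd.
  exact: le_trans (row_sum_le_sigma2 b _) m'_ge.
- move=> j; under eq_bigr do rewrite /beta /cell /= valKd.
  exact: le_trans (col_sum_le_sigma1 b _) n'_ge.
Qed.
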